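(* Let $A\subset\mathbb{Z}$ be a finite nonempty set with characteristic function $\chi_A$, let $1\leq p\leq\infty$, let $k\geq 1$ be an integer, and let $n=\lfloor k/3\rfloor$. Then $$\|\chi_A^{(k)}\|_{l^p(\mathbb{Z})}\geq\frac{1}{3}\binom{k}{n}.$$
   Context: For $f:\mathbb{Z}\to\mathbb{R}$ and an integer $k\geq 1$, the discrete derivative (forward difference) of order $k$ is $f^{(k)}(n):=\sum_{j=0}^{k}\binom{k}{j}(-1)^{j}f(n+k-j)$, $n\in\mathbb{Z}$. *)

(* Defs.v *)
From HB Require Import structures.
From mathcomp Require Import all_boot all_order all_algebra.
From mathcomp Require Import all_classical all_reals all_analysis.

Set Implicit Arguments.
Unset Strict Implicit.
Unset Printing Implicit Defensive.
Import Order.TTheory GRing.Theory Num.Theory.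

Local Open Scope ring_scope.

HB.instance Definition _ := isPointed.Build int 0.

(* Every subset of int is measurable, as the library does for nat and bool. *)
HB.instance Definition _ := @isMeasurable.Build default_measure_display int
  discrete_measurable discrete_measurable0
  discrete_measurableC discrete_measurableU.

Definition fdiff (R : pzRingType) (k : nat) (f : int -> R) : int -> R :=
  fun n => \sum_(j < k.+1) 'C(k, j)%:R * (-1) ^+ j * f (n + k%:Z - j%:Z).

(* The l^p(Z) norm is the L^p norm for the counting measure on int, with values
   in the extended reals.  For p = +oo it is an essential supremum, hence the
   supremum, since only the empty set has counting measure zero. *)
Definition lpnorm (R : realType) (p : \bar R) (f : int -> R) : \bar R :=
  Lnorm (@counting int R) p (EFin \o f).

(* Main.v *)
Require Import Defs.
From mathcomp Require Import all_boot all_order all_algebra.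
From mathcomp Require Import all_classical all_reals all_analysis.
From mathcomp Require Import ess_sup_inf.
From mathcomp Require Import zify ring lra.

(** Only the left end of [A] matters.  Let [m] be the least element of [A] and
    [f] its indicator.  At the point [m + n - k] the [k]-th difference is the
    convolution sum [\sum_(j <= n) (-1)^j 'C(k, j) f (m + n - j)]: the terms with
    [j > n] vanish because they look to the left of [m], and the term [j = n] is
    [(-1)^n 'C(k, n)] because [f m = 1].  As long as [3 n <= k], the binomial
    coefficients at least double at each step up to [n], so the terms whose sign
    is opposite to that of the last one are dominated by the geometric series
    [(1/2 + 1/8 + 1/32 + ...) 'C(k, n) = 2/3 'C(k, n)], whatever values
    between 0 and 1 the function [f] takes.  A third of ['C(k, n)] survives
    ([fdiff_left_end_ge]), and for the counting measure every pointwise value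
    is bounded by the [l^p] norm ([lpnorm_ge_normr]). *)

Set Implicit Arguments.
Unset Strict Implicit.
Unset Printing Implicit Defensive.
Import Order.TTheory GRing.Theory Num.Theory.
Local Open Scope classical_set_scope.
Local Open Scope ring_scope.

Lemma leq_double_bin (k n : nat) :
  (3 * n.+1 <= k)%N -> (2 * 'C(k, n) <= 'C(k, n.+1))%N.
Proof. by move=> kn; have := mul_bin_left k n; nia. Qed.

(** The two bounds have to be carried together: adding a term flips the sign, so
    each bound at [n.+1] comes from the other one at [n], and the constants
    [2/3] and [1/3] are the fixed point of that exchange under doubling. *)
Lemma alternating_bin_sum_bounds (R : realFieldType) (k n : nat) (b : nat -> R) :
  (3 * n <= k)%N -> (forall j, 0 <= b j <= 1) ->
  - (2 / 3 * 'C(k, n)%:R) <=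
    (-1) ^+ n * (\sum_(j < n) 'C(k, j)%:R * (-1) ^+ j * b j)
  <= 1 / 3 * 'C(k, n)%:R.
Proof.
move=> + b01; elim: n => [|n IHn] kn.
  by rewrite big_ord0 bin0; lra.
have /andP[lo hi] := IHn ltac:(lia).
have := leq_double_bin kn; rewrite -(ler_nat R) natrM => dbl.
rewrite big_ord_recr /= mulrDr exprS.
set C := 'C(k, n)%:R in lo hi dbl *; set D := 'C(k, n.+1)%:R in dbl *.
set S := \sum_(j < n) _ in lo hi *.
have -> : -1 * (-1) ^+ n * (C * (-1) ^+ n * b n) = - (C * b n).
  have := sqrr_sign R n; set s := (-1) ^+ n => s2.
  by rewrite -[C in RHS]mulr1 -[in RHS]s2; ring.
have C0 : 0 <= C by rewrite ler0n.
have /andP[b0 b1] := b01 n.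
have Cb0 : 0 <= C * b n by rewrite mulr_ge0.
have Cb1 : C * b n <= C by rewrite ler_piMr.
by rewrite mulN1r mulNr; apply/andP; split; lra.
Qed.

(** Of [f] the sum only sees the [n.+1] points from [m] to [m + n], and the value
    at [m] carries the last and largest coefficient. *)
Lemma fdiff_left_end_ge (R : realFieldType) (k n : nat) (f : int -> R) (m : int) :
  (3 * n <= k)%N -> (forall i, 0 <= f i <= 1) ->
  (forall i, i < m -> f i = 0) -> f m = 1 ->
  1 / 3 * 'C(k, n)%:R <= `|fdiff k f (m + n%:Z - k%:Z)|.
Proof.
move=> kn f01 fm0 fm1.
have -> : fdiff k f (m + n%:Z - k%:Z) =
    \sum_(j < n.+1) 'C(k, j)%:R * (-1) ^+ j * f (m + n%:Z - j%:Z).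
  rewrite /fdiff subrK.
  rewrite [RHS](big_ord_widen k.+1
    (fun j => 'C(k, j)%:R * (-1) ^+ j * f (m + n%:Z - j%:Z))); last by lia.
  rewrite [RHS]big_mkcond /=; apply: eq_bigr => j _.
  by case: ltnP => // nj; rewrite fm0 ?mulr0//; lia.
rewrite big_ord_recr /= addrK fm1 mulr1.
have /andP[lo _] := @alternating_bin_sum_bounds R k n
  (fun j => f (m + n%:Z - j%:Z)) kn (fun=> f01 _).
(* Multiplying by the sign of the last term makes that term positive. *)
rewrite -[leRHS](normrMsign n) mulrDr [X in _ + X]mulrCA.
rewrite -expr2 sqrr_sign mulr1.
by apply: le_trans (ler_norm _); lra.
Qed.

Lemma counting_set1 (R : realType) (T : choiceType) (x : T) :
  counting [set x] = 1%E :> \bar R.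
Proof.
by rewrite /counting asboolT ?fset_set1 ?finmap.cardfs1.
Qed.

Lemma counting_ge1 (R : realType) (B : set int) (x : int) :
  B x -> (1 <= @counting int R B)%E.
Proof.
move=> Bx; rewrite -(counting_set1 R x).
by apply: (le_measure (@counting int R)); rewrite ?inE// => y ->.
Qed.

(** For finite [p], the integral is bounded below by its part over the atom
    [[set x]], which has mass one. *)
Lemma lpnorm_ge_normr (R : realType) (p : \bar R) (f : int -> R) (x : int) :
  (0 < p)%E -> (`|f x|%:E <= lpnorm p f)%E.
Proof.
move=> p0; rewrite /lpnorm; case: p p0 => [r| |//] p0.
- have r0 : 0 < r by rewrite -lte_fin.
  have point_le : ((`|f x| `^ r)%:E <=
      \int[@counting int R]_y `|(EFin \o f) y| `^ r)%E.
    apply: (@le_trans _ _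
      (\int[@counting int R]_(y in [set x]) `|(EFin \o f) y| `^ r)%E).
      rewrite (eq_integral (cst (`|f x| `^ r)%:E)); last first.
        by move=> y; rewrite inE /= => ->.
      by rewrite integral_cst//= counting_set1 mule1.
    apply: ge0_subset_integral => //.
    by move=> y _; exact: poweR_ge0.
  have root : (`|f x| `^ r) `^ r^-1 = `|f x|.
    by rewrite -powRrM mulfV ?gt_eqF// powRr1.
  rewrite unlock -[X in X%:E]root -poweR_EFin.
  apply: gt0_ler_poweR => //; rewrite ?in_itv /= ?leey ?andbT.
  + by rewrite invr_ge0 ltW.
  + by rewrite lee_fin powR_ge0.
  + by apply: integral_ge0 => y _; rewrite lee_fin powR_ge0.
- rewrite unlock /=.
  have -> : (0 < @counting int R setT)%E.
    exact: (lt_le_trans _ (counting_ge1 R (x := x) _)).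
  (* A point where the bound failed would lie in a null set, yet points have mass one. *)
  have [N [_ N0 sN]] := ess_sup_ge (@counting int R) (abse \o (EFin \o f)).
  rewrite leNgt; apply/negP => lt_fx.
  have /(counting_ge1 R) : N x by apply: sN => /=; apply/negP; rewrite -ltNge.
  by rewrite [X in (_ <= X)%E]N0 lee_fin ler10.
Qed.

Lemma finite_set_has_min (A : set int) :
  finite_set A -> A !=set0 -> exists2 m, A m & forall i, A i -> m <= i.
Proof.
move=> /finite_seqP[s ->] [x xs].
rewrite /= -index_mem in xs.
case: (@Order.TotalTheory.arg_minP _ _ _ (Ordinal xs) predT
  (fun i => s`_i) isT) => i _ imin.
exists s`_i; first by rewrite /= mem_nth.
by move=> y /= /(nthP 0)[j js <-]; exact: (imin (Ordinal js) isT).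
Qed.

Theorem theorem2 (R : realType) (A : set int) (p : \bar R) (k : nat)
  (finA : finite_set A) (A0 : A !=set0)
  (p1 : (1 <= p)%E) (k1 : (1 <= k)%N) :
  ((1 / 3 * 'C(k, (k %/ 3)%N)%:R)%:E <= lpnorm p (fdiff k (\1_A : int -> R)))%E.
Proof.
have [m Am mmin] := finite_set_has_min finA A0.
apply: (le_trans _ (lpnorm_ge_normr _ (m + (k %/ 3)%N%:Z - k%:Z) _)); last first.
  by rewrite (lt_le_trans _ p1).
rewrite lee_fin; apply: fdiff_left_end_ge.
- by rewrite mulnC leq_trunc_div.
- by move=> i; rewrite indicE; case: (i \in A); rewrite /= ?lexx ler01.
- move=> i im; rewrite indicE memNset// => /mmin.
  by rewrite leNgt im.
- by rewrite indicE mem_set.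
Qed.
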